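(* Let $\mathcal{A}$ be an affine hyperplane arrangement in a $d$-dimensional vector space $V$ over a field $\mathbb{F}$, and write its Tutte polynomial as $T_{\mathcal{A}}(x,y)=\sum_{i,j\ge 0}t_{ij}x^iy^j$. For $0\le n\le|\mathcal{A}|$ let $c_n:=\#\{\mathcal{B}\in\mathcal{C}_{\mathcal{A}}:|\mathcal{B}|=n\}$ be the number of central subarrangements of size $n$. Then, for all integers $k\ge 0$, \[ \sum_{i=0}^{k}\sum_{j=0}^{k-i}\binom{k-i}{j}(-1)^jt_{ij}=\sum_{n=0}^{|\mathcal{A}|}(-1)^{r(\mathcal{A})+n}c_n\binom{k+n-r(\mathcal{A})}{k}. \]
   Context: An affine hyperplane arrangement $\mathcal{A}$ is a finite set of affine hyperplanes in a $d$-dimensional vector space $V$ over a field $\mathbb{F}$. A subarrangement $\mathcal{B}\subseteq\mathcal{A}$ is central if $\bigcap_{H\in\mathcal{B}}H\neq\emptyset$ (the empty subarrangement has intersection $V$ and is central). $\mathcal{C}_{\mathcal{A}}$ denotes the collection of central subarrangements. For $\mathcal{B}\in\mathcal{C}_{\mathcal{A}}$, $r_{\mathcal{A}}(\mathcal{B}):=d-\dim\bigcap_{H\in\mathcal{B}}H$, and $r(\mathcal{A}):=\max\{r_{\mathcal{A}}(\mathcal{B}):\mathcal{B}\in\mathcal{C}_{\mathcal{A}}\}$ (the common rank of all maximal central subarrangements). Tutte polynomial: $T_{\mathcal{A}}(x,y):=\sum_{\mathcal{B}\in\mathcal{C}_{\mathcal{A}}}(x-1)^{r(\mathcal{A})-r_{\mathcal{A}}(\mathcal{B})}(y-1)^{|\mathcal{B}|-r_{\mathcal{A}}(\mathcal{B})}$.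 Binomial convention: for integers $a,b$, $\binom{a}{b}=\frac{a(a-1)\cdots(a-b+1)}{b!}$ if $b\ge 0$ (also for negative $a$), and $\binom{a}{b}=0$ if $b<0$. *)

(* Defs.v *)
From HB Require Import structures.
From mathcomp Require Import all_boot all_order all_algebra finmap.
From mathcomp Require Import boolp classical_sets.

Set Implicit Arguments.
Unset Strict Implicit.
Unset Printing Implicit Defensive.

Import Order.TTheory GRing.Theory Num.Theory.

Local Open Scope fset_scope.
Local Open Scope classical_set_scope.
Local Open Scope ring_scope.

Section Arrangements.
Variables (F : fieldType) (V : vectType F).
Implicit Types (S H : set V) (A B : {fset set V}).

Definition affine_subspace (p : V) (W : {vspace V}) : set V :=
  [set p + w | w in [set w : V | w \in W]].

Definition is_affine_hyperplane H : Prop :=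
  exists (p : V) (W : {vspace V}),
    (\dim W).+1 = \dim {:V} /\ H = affine_subspace p W.

Definition is_arrangement A : Prop :=
  forall H, H \in A -> is_affine_hyperplane H.

Definition arr_inter B : set V := \bigcap_(H in [set` B]) H.

Definition central B : bool := `[< arr_inter B !=set0 >].

Definition affine_dim S : nat :=
  \dim (xget 0%VS [set W : {vspace V} | exists p, S = affine_subspace p W]).

(* On an affine subspace the choice made by xget is forced; other sets, for
   which xget may return its default, only arise from non-central B. *)
Lemma affine_dimE p (W : {vspace V}) :
  affine_dim (affine_subspace p W) = \dim W.
Proof.
rewrite /affine_dim; congr (\dim _); apply: xget_unique; first by exists p.
move=> W' [q eqS].
have sub q1 q2 (W1 W2 : {vspace V}) :
    affine_subspace q1 W1 `<=` affine_subspace q2 W2 -> (W1 <= W2)%VS.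
  move=> sub12; apply/subvP => w wW1.
  have [w1 w1W2 e1] := sub12 (q1 + w) (ex_intro2 _ _ w wW1 erefl).
  have [w0 w0W2 e0] := sub12 (q1 + 0) (ex_intro2 _ _ 0 (mem0v W1) erefl).
  have -> : w = w1 - w0.
    by rewrite -[w](addKr q1) -e1 -[in X in - X + _](addr0 q1) -e0 opprD addrACA
      addNr add0r addrC.
  exact: rpredB.
by apply/eqP; rewrite eqEsubv; apply/andP; split;
  [apply: (sub q p) | apply: (sub p q)]; rewrite eqS.
Qed.

Definition arr_rank B : nat := (\dim {:V} - affine_dim (arr_inter B))%N.

Definition total_rank A : nat :=
  \max_(B <- fpowerset A | central B) arr_rank B.

(* A polynomial in x = 'X with coefficients polynomials in y = 'X%:P. For an
   arrangement, no truncation occurs in the exponents. *)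
Definition tutte A : {poly {poly int}} :=
  \sum_(B <- fpowerset A | central B)
    ('X - 1) ^+ (total_rank A - arr_rank B) *
    ('X%:P - 1) ^+ (#|` B| - arr_rank B).

Definition tutte_coef A (i j : nat) : int := (tutte A)`_i`_j.

Definition num_central A (n : nat) : nat :=
  #|` [fset B in fpowerset A | central B && (#|` B| == n)] |.

End Arrangements.

Definition binz (a b : int) : rat :=
  match b with
  | Posz m => (\prod_(i < m) (a%:~R - i%:R)) / m`!%:R
  | Negz _ => 0
  end.

(* Main.v *)
Require Import Defs.
From mathcomp Require Import all_boot all_order all_algebra finmap.
From mathcomp Require Import boolp classical_sets.
From mathcomp Require Import ring zify.

Import GRing.Theory Num.Theory.

Local Open Scope fset_scope.
Local Open Scope classical_set_scope.
Local Open Scope ring_scope.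

(** The left-hand side is a linear functional of the Tutte polynomial
    [p = \sum p_ij x^i y^j]. Its values over all k have generating function
    [\sum_k L_k(p) z^k = p(z, z / (z - 1)) / (1 - z)], since the term x^i y^j
    contributes z^i (-z)^j / (1 - z)^(j + 1). The substitution parametrises the
    hyperbola (x - 1)(y - 1) = 1, so it turns (x - 1)^a (y - 1)^b into
    (z - 1)^(a - b): only the difference a - b matters, and the coefficient of
    z^k is (-1)^(a + b) binom(k + b - a, k). For the summand of a central B,
    a = r(A) - r(B) and b = |B| - r(B), so b - a = |B| - r(A) does not involve
    r(B), and grouping the central B by cardinality gives the right-hand side.

    Power series are avoided here: multiplying p by x - 1 or by y - 1 acts on
    the sequence L_k by the recurrences [tutte_transformS_subX1] and
    [tutte_transformS_subY1], which Pascal's rule shows the binomial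
    coefficients to satisfy as well; [tutte_transform_monomial] is the resulting
    value. The one geometric input is that both exponents are honest
    differences, i.e. r(B) <= r(A), which holds by maximality, and r(B) <= |B|
    ([arr_rank_le_card]), because n hyperplanes through a common point meet in
    codimension at most n. *)

(** * Binomial coefficients with integer upper argument *)

Lemma binz0 (a : int) : binz a 0%:Z = 1.
Proof. by rewrite /binz big_ord0 divr1. Qed.

Lemma binzSr (a : int) (m : nat) :
  binz a m.+1 = binz a m * (a%:~R - m%:R) / m.+1%:R.
Proof.
rewrite /binz big_ord_recr /= factS natrM invfM.
ring.
Qed.

(** Pascal's rule follows from two one-step recurrences: one extends the falling
    product at its lower end, the other ([absorb]) at its upper end. *)
Lemma binz_pascal (a : int) (m : nat) :
  binz (a + 1) m.+1 = binz a m.+1 + binz a m.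
Proof.
have nz n : n.+1%:R != 0 :> rat by rewrite pnatr_eq0.
have absorb : binz (a + 1) m.+1 = (a%:~R + 1) / m.+1%:R * binz a m.
  elim: m => [|m IHm].
    by rewrite binzSr !binz0 intrD; ring.
  rewrite binzSr IHm binzSr intrD -!natr1; field.
  by rewrite !natr1 !nz.
rewrite absorb binzSr -!natr1; field.
by rewrite natr1 nz.
Qed.

Lemma binz_nat (n m : nat) : binz n m = 'C(n, m)%:R.
Proof.
elim: n m => [|n IHn] [|m]; rewrite ?binz0 ?bin0 //.
  by rewrite bin0n /binz big_ord_recl /= subrr !mul0r.
by rewrite -addn1 PoszD binz_pascal !IHn addn1 binS natrD.
Qed.

(** * The functional on polynomials in y *)

(** With D the map q |-> (q - q(0)) / X, the value is ((1 - D)^m q)(0); its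
    generating function in m is q(z / (z - 1)) / (1 - z). *)
Definition binomial_transform (m : nat) (q : {poly int}) : int :=
  \sum_(j < m.+1) (-1) ^+ j * 'C(m, j)%:R * q`_j.

Lemma binomial_transformB m (p q : {poly int}) :
  binomial_transform m (p - q) = binomial_transform m p - binomial_transform m q.
Proof.
by rewrite /binomial_transform -sumrB; apply: eq_bigr => j _; rewrite coefB mulrBr.
Qed.

Lemma binomial_transform0X (q : {poly int}) : binomial_transform 0 ('X * q) = 0.
Proof. by rewrite /binomial_transform big_ord1 coefXM mulr0. Qed.

(** Pascal's rule C(m + 1, j + 1) - C(m, j + 1) = C(m, j), coefficientwise. *)
Lemma binomial_transformSX m (q : {poly int}) :
  binomial_transform m.+1 ('X * q) =
  binomial_transform m ('X * q) - binomial_transform m q.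
Proof.
have widen : binomial_transform m ('X * q) =
    \sum_(j < m.+2) (-1) ^+ j * 'C(m, j)%:R * ('X * q)`_j.
  (* The extra term vanishes because C(m, m + 1) = 0. *)
  by rewrite big_ord_recr /= bin_small // mulr0 mul0r addr0.
rewrite widen /binomial_transform big_ord_recl [in RHS]big_ord_recl.
rewrite !coefXM !mulr0 !add0r -sumrB; apply: eq_bigr => j _.
rewrite lift0 !coefXM /= binS natrD exprS.
ring.
Qed.

Lemma binomial_transform0_subX1 (q : {poly int}) :
  binomial_transform 0 (('X - 1) * q) = - binomial_transform 0 q.
Proof. by rewrite mulrBl mul1r binomial_transformB binomial_transform0X sub0r. Qed.

(** In terms of generating functions, y - 1 becomes 1 / (z - 1) when
    y = z / (z - 1), so multiplying back by z - 1 recovers q. *)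
Lemma binomial_transformS_subX1 m (q : {poly int}) :
  binomial_transform m.+1 (('X - 1) * q) =
  binomial_transform m (('X - 1) * q) - binomial_transform m.+1 q.
Proof.
rewrite mulrBl mul1r !binomial_transformB binomial_transformSX; ring.
Qed.

(** * The functional on polynomials in x and y *)

Definition tutte_transform (k : nat) (p : {poly {poly int}}) : int :=
  \sum_(i < k.+1) binomial_transform (k - i) p`_i.

Lemma tutte_transformB k p q :
  tutte_transform k (p - q) = tutte_transform k p - tutte_transform k q.
Proof.
by rewrite /tutte_transform -sumrB; apply: eq_bigr => i _; rewrite coefB binomial_transformB.
Qed.

Lemma tutte_transform_sum (I : Type) (r : seq I) (P : pred I)
    (f : I -> {poly {poly int}}) k :
  tutte_transform k (\sum_(i <- r | P i) f i) =
  \sum_(i <- r | P i) tutte_transform k (f i).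
Proof.
have T0 : tutte_transform k 0 = 0.
  by rewrite -[0](subrr 0) tutte_transformB subrr.
apply: big_morph => // p q.
by rewrite -{1}[q]opprK -[- q]sub0r !tutte_transformB T0 sub0r opprK.
Qed.

Lemma tutte_transform1 k : tutte_transform k 1 = 1.
Proof.
rewrite /tutte_transform big_ord_recl big1 => [|i _].
  rewrite addr0 coef1 /binomial_transform big_ord_recl big1 => [|j _].
    by rewrite coef1 bin0 !mulr1 addr0.
  by rewrite coef1 mulr0.
by rewrite coef1; apply: big1 => j _; rewrite coef0 mulr0.
Qed.

Lemma tutte_transform0_subX1 p :
  tutte_transform 0 (('X - 1) * p) = - tutte_transform 0 p.
Proof.
rewrite mulrBl mul1r tutte_transformB /tutte_transform !big_ord1 coefXM /=.
by rewrite /binomial_transform big_ord1 coef0 mulr0 sub0r.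
Qed.

(** Since x becomes z in the generating function, multiplication by x shifts
    the index k. *)
Lemma tutte_transformS_subX1 k p :
  tutte_transform k.+1 (('X - 1) * p) =
  tutte_transform k p - tutte_transform k.+1 p.
Proof.
rewrite mulrBl mul1r tutte_transformB; congr (_ - _).
rewrite {1}/tutte_transform big_ord_recl coefXM /= [binomial_transform _ _]big1.
  by rewrite add0r; apply: eq_bigr => i _; rewrite coefXM.
by move=> j _; rewrite coef0 mulr0.
Qed.

Lemma coef_polyC_sub1M (p : {poly {poly int}}) i :
  (('X%:P - 1) * p)`_i = ('X - 1) * p`_i.
Proof. by rewrite -polyC1 -polyCB coefCM. Qed.

Lemma tutte_transform0_subY1 p :
  tutte_transform 0 (('X%:P - 1) * p) = - tutte_transform 0 p.
Proof.
by rewrite /tutte_transform !big_ord1 coef_polyC_sub1M binomial_transform0_subX1.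
Qed.

Lemma tutte_transformS_subY1 k p :
  tutte_transform k.+1 (('X%:P - 1) * p) =
  tutte_transform k (('X%:P - 1) * p) - tutte_transform k.+1 p.
Proof.
rewrite /tutte_transform big_ord_recr [X in _ = _ - X]big_ord_recr /= subnn.
rewrite !coef_polyC_sub1M binomial_transform0_subX1 opprD addrA -sumrB.
congr (_ - _); apply: eq_bigr => i _.
by rewrite coef_polyC_sub1M subSn ?binomial_transformS_subX1 // -ltnS.
Qed.

(** The induction on b, inside which k is varied by a second induction, needs
    the recurrence in y for a = 0 only; the induction on a then covers every b.
    Each step is one use of Pascal's rule. *)
Lemma tutte_transform_monomial k a b :
  (tutte_transform k (('X - 1) ^+ a * ('X%:P - 1) ^+ b))%:~R =
  (-1) ^+ (a + b) * binz (k%:Z + b%:Z - a%:Z) k%:Z :> rat.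
Proof.
elim: a k => [|a IHa] k.
  rewrite expr0 mul1r add0n subr0; elim: b k => [|b IHb] k.
    by rewrite !expr0 tutte_transform1 mul1r addr0 binz_nat binn.
  rewrite exprS; elim: k => [|k IHk].
    by rewrite tutte_transform0_subY1 intrN IHb !binz0 !mulr1 exprS mulN1r.
  rewrite tutte_transformS_subY1 intrB IHk IHb.
  rewrite (_ : k.+1%:Z + b.+1%:Z = k.+1%:Z + b%:Z + 1); last by lia.
  rewrite binz_pascal (_ : k%:Z + b.+1%:Z = k.+1%:Z + b%:Z); last by lia.
  rewrite !exprS; ring.
rewrite exprS -mulrA; case: k => [|k].
  by rewrite tutte_transform0_subX1 intrN IHa !binz0 !mulr1 addSn exprS mulN1r.
rewrite tutte_transformS_subX1 intrB !IHa.
rewrite (_ : k.+1%:Z + b%:Z - a%:Z = k%:Z + b%:Z - a%:Z + 1); last by lia.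
rewrite binz_pascal (_ : k.+1%:Z + b%:Z - a.+1%:Z = k%:Z + b%:Z - a%:Z); last by lia.
rewrite addSn exprS; ring.
Qed.

(** * Ranks and cardinals of central subarrangements *)

Section Rank.
Variables (F : fieldType) (V : vectType F).

Lemma affine_subspaceP (p x : V) (W : {vspace V}) :
  affine_subspace p W x <-> x - p \in W.
Proof.
split=> [[w wW <-]|xpW]; first by rewrite addrC addKr.
by exists (x - p); rewrite // addrC subrK.
Qed.

Lemma affine_hyperplane_at (p : V) (H : set V) : is_affine_hyperplane H -> H p ->
  exists2 W : {vspace V}, (\dim W).+1 = \dim {:V} & H = affine_subspace p W.
Proof.
move=> [q [W [dimW ->]]] /affine_subspaceP pqW; exists W => //.
apply/seteqP; split=> x /affine_subspaceP xW; apply/affine_subspaceP.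
  by rewrite -[x - p](subrKA q) -[q - p]opprB rpredB.
by rewrite -[x - q](subrKA p) rpredD.
Qed.

(** Taking the common point p as base point makes the intersection of affine
    subspaces the intersection of their directions, and each hyperplane direction
    lowers the dimension by at most one by Grassmann's formula. *)
Lemma hyperplanes_inter (p : V) (s : seq (set V)) :
    (forall H, H \in s -> is_affine_hyperplane H) ->
    (forall H, H \in s -> H p) ->
  exists2 W : {vspace V}, (\dim {:V} <= \dim W + size s)%N &
    \bigcap_(H in [set` s]) H = affine_subspace p W.
Proof.
elim: s => [|H s IHs] hs ps.
  exists fullv; first by rewrite addn0.
  by apply/seteqP; split=> x // _; apply/affine_subspaceP; rewrite memvf.
have [||W dimW eW] := IHs.
- by move=> G Gs; apply: hs; rewrite inE Gs orbT.
- by move=> G Gs; apply: ps; rewrite inE Gs orbT.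
have [||U dimU eU] := affine_hyperplane_at p H.
- by apply: hs; rewrite mem_head.
- by apply: ps; rewrite mem_head.
exists (U :&: W)%VS.
  have := dimv_leqif_sup (subvf (U + W)%VS); have := dimv_sum_cap U W.
  by move=> sumE [+ _]; rewrite /=; lia.
have cap x : affine_subspace p (U :&: W) x <-> H x /\ (\bigcap_(G in [set` s]) G) x.
  by rewrite eW eU !affine_subspaceP memv_cap; split=> /andP.
apply/seteqP; split=> x; rewrite cap.
  move=> xs; split; first by apply: xs; rewrite /= mem_head.
  by move=> G Gs; apply: xs; rewrite /= inE Gs orbT.
by move=> [Hx xs] G; rewrite /= inE => /orP[/eqP->//|]; apply: xs.
Qed.

Lemma arr_rank_le_card (B : {fset set V}) :
  is_arrangement B -> central B -> (arr_rank B <= #|` B|)%N.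
Proof.
move=> hB /asboolP[p pB].
have [W dimW eW] := hyperplanes_inter p B hB pB.
by rewrite /arr_rank /arr_inter eW affine_dimE leq_subLR.
Qed.

Lemma arr_rank_le_total (A B : {fset set V}) :
  (B `<=` A)%fset -> central B -> (arr_rank B <= total_rank A)%N.
Proof.
by move=> BA cB; apply: leq_bigmax_seq => //; rewrite fpowersetE.
Qed.

Lemma sum_central_by_card (A : {fset set V}) (f : nat -> rat) :
  \sum_(0 <= n < #|` A|.+1) (num_central A n)%:R * f n =
  \sum_(B <- fpowerset A | central B) f #|` B|.
Proof.
under eq_bigr => n _ do
  rewrite /num_central card_fset_sum1 natr_sum mulr_suml big_fset big_mkcondr /=.
rewrite exchange_big /= big_seq_cond [RHS]big_seq_cond.
apply: eq_bigr => B /andP[]; rewrite fpowersetE => /fsubset_leq_card leBA _.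
under eq_bigr => n _ do rewrite mul1r eq_sym.
by rewrite -big_mkcond big_nat1_eq ltnS leBA.
Qed.

End Rank.

(** * Evaluation on the Tutte polynomial *)

Lemma tutte_transformE k (p : {poly {poly int}}) :
  \sum_(0 <= i < k.+1) \sum_(0 <= j < (k - i).+1)
      binz (k%:Z - i%:Z) j%:Z * (-1) ^+ j * (p`_i`_j)%:~R
  = (tutte_transform k p)%:~R.
Proof.
rewrite [RHS]rmorph_sum big_mkord; apply: eq_bigr => i _.
rewrite [RHS]rmorph_sum big_mkord; apply: eq_bigr => j _.
rewrite subzn -1?ltnS // binz_nat !rmorphM /= rmorph_sign rmorph_nat.
by rewrite [_ * (-1) ^+ j]mulrC.
Qed.

Theorem corollary3p1 (F : fieldType) (V : vectType F) (A : {fset set V})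
    (hA : is_arrangement A) (k : nat) :
  \sum_(0 <= i < k.+1) \sum_(0 <= j < (k - i).+1)
      binz (k%:Z - i%:Z) j%:Z * (-1) ^+ j * (tutte_coef A i j)%:~R
  = \sum_(0 <= n < #|` A|.+1)
      (-1) ^+ (total_rank A + n) * (num_central A n)%:R *
      binz (k%:Z + n%:Z - (total_rank A)%:Z) k%:Z.
Proof.
rewrite tutte_transformE /tutte tutte_transform_sum rmorph_sum.
under [RHS]eq_bigr => n _ do rewrite [_ * (num_central A n)%:R]mulrC -mulrA.
rewrite sum_central_by_card big_seq_cond [RHS]big_seq_cond.
apply: eq_bigr => B /andP[]; rewrite fpowersetE => BA cB.
have leA := arr_rank_le_total _ _ _ _ BA cB.
have leB : (arr_rank B <= #|` B|)%N.
  by apply: arr_rank_le_card cB => H /(fsubsetP BA); apply: hA.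
apply: etrans (tutte_transform_monomial _ _ _) _.
(* The rank of B cancels from b - a, and occurs twice in a + b. *)
rewrite -(subzn leA) -(subzn leB); congr (_ * binz _ _); last by ring.
rewrite -[LHS]signr_odd -[RHS]signr_odd; congr (_ ^+ _).
by rewrite !oddD (oddB leA) (oddB leB) addbACA addbb addbF.
Qed.
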